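(* Let $(T_1,T_2)$ be a pair of doubly twisted isometries on a complex Hilbert space $\mathcal{H}$. Then there is a unique orthogonal decomposition $$\mathcal{H}=\mathcal{H}_{uu}\oplus\mathcal{H}_{us}\oplus\mathcal{H}_{su}\oplus\mathcal{H}_{ss},$$ where $\mathcal{H}_{uu},\mathcal{H}_{us},\mathcal{H}_{su},\mathcal{H}_{ss}$ are closed subspaces reducing both $T_1$ and $T_2$ such that - $T_1|_{\mathcal{H}_{uu}}$ and $T_2|_{\mathcal{H}_{uu}}$ are unitary; - $T_1|_{\mathcal{H}_{us}}$ is unitary and $T_2|_{\mathcal{H}_{us}}$ is a unilateral shift; - $T_1|_{\mathcal{H}_{su}}$ is a unilateral shift and $T_2|_{\mathcal{H}_{su}}$ is unitary; - $T_1|_{\mathcal{H}_{ss}}$ and $T_2|_{\mathcal{H}_{ss}}$ are unilateral shifts. Also, $$\mathcal{H}_{uu}=\bigcap_{m_1,m_2\in\mathbb{Z}_+}T_1^{m_1}T_2^{m_2}\mathcal{H},\qquad \mathcal{H}_{us}=\bigoplus_{m_2=0}^{\infty}T_2^{m_2}\Big(\bigcap_{m_1=0}^{\infty}T_1^{m_1}\mathcal{N}(T_2^* )\Big),$$ $$\mathcal{H}_{su}=\bigoplus_{m_1=0}^{\infty}T_1^{m_1}\Big(\bigcap_{m_2=0}^{\infty}T_2^{m_2}\mathcal{N}(T_1^* )\Big),\qquad \mathcal{H}_{ss}=\bigoplus_{m_1,m_2=0}^{\infty}T_1^{m_1}T_2^{m_2}\Big(\mathcal{N}(T_1^* )\cap\mathcal{N}(T_2^*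 )\Big).$$
   Context: $\mathcal{H}$ is a complex Hilbert space, $\mathbb{Z}_+=\{0,1,2,\ldots\}$, $\mathcal{N}(T)$ is the kernel of $T$. A closed subspace $\mathcal{M}$ reduces $T$ if $T\mathcal{M}\subseteq\mathcal{M}$ and $T\mathcal{M}^\perp\subseteq\mathcal{M}^\perp$. A unilateral shift, of arbitrary multiplicity, is an isometry $V$ with $V^{*m}\to0$ strongly as $m\to\infty$ (equivalently, a completely non-unitary isometry); the operator on $\{0\}$ is allowed, so any of the four subspaces may be $\{0\}$. A pair of doubly twisted isometries on $\mathcal{H}$ is a pair $(T_1,T_2)$ of isometries for which there is a unitary $U$ on $\mathcal{H}$ (the twist) with $$T_1T_2=UT_2T_1,\qquad T_1^*T_2=U^*T_2T_1^*,\qquad T_1U=UT_1,\quad T_2U=UT_2.$$ *)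

(* Defs.v *)
From mathcomp Require Import all_boot all_order all_algebra.
From mathcomp Require Import all_classical all_reals all_analysis.
From mathcomp Require Import complex.

Set Implicit Arguments.
Unset Strict Implicit.
Unset Printing Implicit Defensive.

Import Order.TTheory GRing.Theory Num.Theory.
Import numFieldNormedType.Exports.

Local Open Scope classical_set_scope.
Local Open Scope ring_scope.
Local Open Scope complex_scope.

Section HilbertOperators.

(* A complex Hilbert space is [H] together with an inner product [dot] (linear
   in its first argument) such that [hilbert_norm dot] holds. *)
Context {R : realType} {H : completeNormedModType R[i]}.
Variable dot : {dot H for Num.conj}.

Definition hilbert_norm : Prop := forall x : H, `|x| ^+ 2 = dot x x.

Definition closed_subspace (M : set H) : Prop :=
  [/\ closed M, M 0 & forall (a : R[i]) (x y : H), M x -> M y -> M (a *: x + y)].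

Definition orthocomp (M : set H) : set H :=
  [set x | forall y, M y -> dot x y = 0].

(* Hilbert-space direct sum, possibly infinite: [M] is the closed linear span
   of the pairwise orthogonal closed subspaces [N i]. *)
Definition is_orthogonal_sum (I : Type) (M : set H) (N : I -> set H) : Prop :=
  [/\ forall i, closed_subspace (N i),
      forall i j, i <> j -> N i `<=` orthocomp (N j)
    & M = smallest closed_subspace (\bigcup_i N i)].

(* The adjoint of the restriction of [T] to [M], as an operator on the Hilbert
   space [M].  For [T] bounded on the closed invariant subspace [M] and [y] in
   [M], the vector [z] below exists by the Riesz representation theorem and is
   unique. *)
Definition adjoint_on (M : set H) (T : H -> H) (y : H) : H :=
  xget 0 [set z | M z /\ forall x, M x -> dot (T x) y = dot x z].

Definition adjoint (T : H -> H) : H -> H := adjoint_on setT T.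

Definition reduces (M : set H) (T : H -> H) : Prop :=
  [/\ closed_subspace M, T @` M `<=` M & T @` orthocomp M `<=` orthocomp M].

(* The predicates [P_on M T] below say that the restriction of [T] to the
   closed subspace [M] is an operator on [M] with property [P]. *)
Definition isometry_on (M : set H) (T : H -> H) : Prop :=
  forall x, M x -> M (T x) /\ `|T x| = `|x|.

Definition unitary_on (M : set H) (T : H -> H) : Prop :=
  forall x, M x ->
    [/\ M (T x), adjoint_on M T (T x) = x & T (adjoint_on M T x) = x].

Definition shift_on (M : set H) (T : H -> H) : Prop :=
  isometry_on M T /\
  forall x, M x -> iter m (adjoint_on M T) x @[m --> \oo] --> (0 : H).

Definition doubly_twisted (T1 T2 : {linear H -> H}) : Prop :=
  [/\ isometry_on setT T1, isometry_on setT T2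
    & exists U : {linear H -> H},
        unitary_on setT U /\
        [/\ forall x, T1 (T2 x) = U (T2 (T1 x)),
            forall x, adjoint T1 (T2 x) = adjoint U (T2 (adjoint T1 x)),
            forall x, T1 (U x) = U (T1 x)
          & forall x, T2 (U x) = U (T2 x)]].

Definition orthogonal_decomposition4 (M1 M2 M3 M4 : set H) : Prop :=
  [/\ [/\ closed_subspace M1, closed_subspace M2,
          closed_subspace M3 & closed_subspace M4],
      [/\ M1 `<=` orthocomp M2, M1 `<=` orthocomp M3 & M1 `<=` orthocomp M4],
      [/\ M2 `<=` orthocomp M3, M2 `<=` orthocomp M4 & M3 `<=` orthocomp M4]
    & forall x : H, exists x1 x2 x3 x4,
        [/\ M1 x1, M2 x2, M3 x3 & M4 x4] /\ x = x1 + x2 + x3 + x4].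

Definition wold_decomposition (T1 T2 : {linear H -> H})
    (Huu Hus Hsu Hss : set H) : Prop :=
  [/\ orthogonal_decomposition4 Huu Hus Hsu Hss,
      [/\ reduces Huu T1, reduces Hus T1, reduces Hsu T1 & reduces Hss T1],
      [/\ reduces Huu T2, reduces Hus T2, reduces Hsu T2 & reduces Hss T2]
    & [/\ unitary_on Huu T1 /\ unitary_on Huu T2,
          unitary_on Hus T1 /\ shift_on Hus T2,
          shift_on Hsu T1 /\ unitary_on Hsu T2
        & shift_on Hss T1 /\ shift_on Hss T2]].

Definition ker_adjoint (T : H -> H) : set H := adjoint T @^-1` [set 0].

End HilbertOperators.

(* Main.v *)
Require Import Defs.
From mathcomp Require Import all_boot all_order all_algebra.
From mathcomp Require Import all_classical all_reals all_analysis.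
From mathcomp Require Import complex.
From mathcomp Require Import ring lra.

(** An isometry [T] with adjoint [S] splits the space orthogonally into its
    unitary part, the intersection of the ranges of the powers of [T], and its
    shift part, the closed span of the pairwise orthogonal subspaces
    [T ^ n (ker S)]. The shift part consists of the vectors with
    [S ^ n x --> 0] ([shift_part_cvg]), and the unitary part of those fixed by
    all [T ^ n S ^ n] ([unitary_partP]). This one-variable Wold decomposition
    also localizes to every closed subspace [M] invariant under [T] and [S]:
    [M] is the sum of its intersections with the two parts ([wold_split]), and
    [M] meets the shift part in the closed span of the [T ^ n (M & ker S)]
    ([shift_part_span]).

    The twisting relations enter in one place only. Since [T2] and its adjoint
    commute with [T1] and with the adjoint of [T1] up to a factor [U] or its
    inverse, and these factors commute with all four operators, [T2] and its
    adjoint preserve the unitary part of [T1] and the kernel of its adjoint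
    ([reducing_unitary_part_twisted], [reducing_ker_twisted]). The hypothesis is
    symmetric under exchanging the two isometries and inverting the twist
    ([twisted_byC]), so the same holds with [T1] and [T2] exchanged.

    The four summands are then the intersections of a part of [T1] with a part
    of [T2]. Localizing the decomposition of [T2] to the two parts of [T1] shows
    that they span the space; localizing it to the unitary part of [T1] gives
    the formula for [Hus], and by symmetry that for [Hsu]; localizing first
    [T1] to the shift part of [T2] and then [T2] to the kernel of the
    adjoint of [T1] gives the double sum for [Hss].

    For uniqueness, a subspace on which [T1] is unitary lies in the unitary part
    of [T1], and one on which it is a shift lies in the shift part. So any
    other decomposition is contained summand by summand in this one, and two
    orthogonal decompositions related in this way are equal.

    The Hilbert space facts needed here, namely the projection theorem, the
    Riesz representation theorem and the existence of adjoints of isometries,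
    are derived from completeness and the identity [|x| ^ 2 = dot x x]. *)

Set Implicit Arguments.
Unset Strict Implicit.
Unset Printing Implicit Defensive.

Import Order.TTheory GRing.Theory Num.Theory.
Import numFieldNormedType.Exports.

Local Open Scope classical_set_scope.
Local Open Scope ring_scope.
Local Open Scope complex_scope.

(** * Inner product and norm *)

Section HilbertGeometry.

Variables (R : realType) (H : completeNormedModType R[i]).
Variable dot : {dot H for Num.conj}.
Hypothesis dot_norm : hilbert_norm dot.

Lemma dotC x y : dot x y = Num.conj (dot y x).
Proof. by rewrite hermC mul1r. Qed.

Lemma dot0l x : dot 0 x = 0. Proof. exact: linear0l. Qed.

Lemma dot0r x : dot x 0 = 0. Proof. exact: linear0r. Qed.

Lemma dotDl x y z : dot (x + y) z = dot x z + dot y z.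
Proof. exact: linearDl. Qed.

Lemma dotDr x y z : dot x (y + z) = dot x y + dot x z.
Proof. exact: linearDr. Qed.

Lemma dotBl x y z : dot (x - y) z = dot x z - dot y z.
Proof. exact: linearBl. Qed.

Lemma dotBr x y z : dot x (y - z) = dot x y - dot x z.
Proof. exact: linearBr. Qed.

Lemma dotZl a x y : dot (a *: x) y = a * dot x y.
Proof. exact: linearZl_LR. Qed.

Lemma dotZr a x y : dot x (a *: y) = Num.conj a * dot x y.
Proof. exact: linearZr_LR. Qed.

Lemma dot_pythagoras x y : dot x y = 0 ->
  dot (x + y) (x + y) = dot x x + dot y y.
Proof. exact: hnormDd. Qed.

Lemma dot_eq0C x y : dot x y = 0 -> dot y x = 0.
Proof. by rewrite dotC => xy0; rewrite -[LHS]conjCK xy0 conjC0. Qed.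

Lemma dotxx_eq0 x : dot x x = 0 -> x = 0.
Proof. by move/eqP; rewrite dnorm_eq0 => /eqP. Qed.

Lemma dot_inj x y : (forall z, dot z x = dot z y) -> x = y.
Proof.
move=> xy; apply/subr0_eq/dotxx_eq0.
by rewrite dotBr xy subrr.
Qed.

Lemma eq_norm_dot x y : dot x x = dot y y -> `|x| = `|y|.
Proof.
move=> xy; apply/eqP; rewrite -(@eqrXn2 _ 2) ?normr_ge0//.
by rewrite !dot_norm xy.
Qed.

(** Splitting [x] into its component along [y] and the rest: this identity
    yields both the Cauchy-Schwarz inequality and the fact that a closest
    point in a subspace is the foot of a perpendicular. *)
Lemma dot_line x y : y != 0 ->
  let z := x - (dot x y / dot y y) *: y in
  dot z z = dot x x - `|dot x y| ^+ 2 / dot y y.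
Proof.
move=> y0 z; have yy0 : dot y y != 0 by rewrite dnorm_eq0.
have zy : dot z y = 0.
  by rewrite dotBl dotZl divfK// subrr.
have xE : x = z + (dot x y / dot y y) *: y by rewrite subrK.
clearbody z; rewrite [in dot x x]xE dot_pythagoras.
  rewrite dnormZ normrM normfV exprMn (ger0_norm (dnorm_ge0 dot y)).
  by rewrite exprVn expr2 invfM -!mulrA mulVf// mulr1 addrK.
by rewrite dotZr/= zy mulr0.
Qed.

Lemma CauchySchwarz_dot x y : `|dot x y| <= `|x| * `|y|.
Proof.
have [->|y0] := eqVneq y 0; first by rewrite dot0r !normr0 mulr0.
rewrite -(@ler_pXn2r _ 2) ?nnegrE ?mulr_ge0//.
rewrite exprMn !dot_norm -ler_pdivrMr ?dnorm_gt0//.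
by rewrite -subr_ge0 -dot_line// dnorm_ge0.
Qed.

(** * Closed subspaces *)

Lemma closed_norm (M : set H) :
  (forall x, (forall e, 0 < e -> exists2 y, M y & `|x - y| < e) -> M x) ->
  closed M.
Proof.
move=> Mx x clMx; apply: Mx => e e0.
have [|y [My xy]] := clMx (ball x e); first exact: nbhsx_ballx.
by exists y => //; move: xy; rewrite -ball_normE.
Qed.

Lemma closed_approx (M : set H) x : closed M ->
  (forall e, 0 < e -> exists2 y, M y & `|x - y| < e) -> M x.
Proof.
move=> clM Mx; apply: clM => B /nbhs_ballP[e /= e0 xB].
have [y My xy] := Mx e e0; exists y; split=> //; apply: xB.
by rewrite -ball_normE.
Qed.

Section Subspace.
Variable M : set H.
Hypothesis cM : closed_subspace M.

Lemma subspace0 : M 0. Proof. by case: cM. Qed.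

Lemma subspaceD x y : M x -> M y -> M (x + y).
Proof. by case: cM => _ _ MD Mx My; have := MD 1 x y Mx My; rewrite scale1r. Qed.

Lemma subspaceZ a x : M x -> M (a *: x).
Proof.
by case: cM => _ M0 MD Mx; have := MD a x 0 Mx M0; rewrite addr0.
Qed.

Lemma subspaceN x : M x -> M (- x).
Proof. by move=> Mx; rewrite -scaleN1r; exact: subspaceZ. Qed.

Lemma subspaceB x y : M x -> M y -> M (x - y).
Proof. by move=> Mx My; apply: subspaceD => //; exact: subspaceN. Qed.

End Subspace.

Lemma closed_subspaceT : closed_subspace (@setT H).
Proof. by split=> //; exact: closedT. Qed.

Lemma closed_subspaceI (M N : set H) :
  closed_subspace M -> closed_subspace N -> closed_subspace (M `&` N).
Proof.
move=> [clM M0 MD] [clN N0 ND]; split; first exact: closedI.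
  by [].
by move=> a x y [Mx Nx] [My Ny]; split; [exact: MD|exact: ND].
Qed.

Lemma closed_subspace_smallest (A : set H) :
  closed_subspace (smallest closed_subspace A).
Proof.
split.
- by apply: closed_bigI => M [[clM _ _] _].
- by move=> M [[_ M0 _] _].
- move=> a x y Ax Ay M [cM AM]; have [_ _ MD] := cM.
  by apply: MD; [apply: Ax|apply: Ay].
Qed.

Lemma closed_subspace_preimage (S : H -> H) (M : set H) :
  linear S -> (forall x, `|S x| <= `|x|) ->
  closed_subspace M -> closed_subspace (S @^-1` M).
Proof.
move=> linS S1 [clM M0 MD].
have SB x y : S (x - y) = S x - S y.
  by rewrite addrC -scaleN1r linS scaleN1r addrC.
split.
- apply: closed_norm => x Sx; apply: (closed_approx clM) => e e0.
  have [y My xy] := Sx e e0; exists (S y) => //.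
  by rewrite -SB (le_lt_trans (S1 _)).
- by rewrite /preimage/= -(subrr 0) SB subrr.
- by move=> a x y Mx My; rewrite /preimage/= linS; exact: MD.
Qed.

Lemma closed_subspace_functional_ker (f : H -> R[i]) (c : R[i]) :
  (forall a x y, f (a *: x + y) = a * f x + f y) ->
  (forall x, `|f x| <= `|x| * c) ->
  closed_subspace [set x | f x = 0].
Proof.
move=> linf fc.
have f0 : f 0 = 0 by have := linf (-1) 0 0; rewrite scaler0 addr0 mulN1r addNr.
split=> [||a x y /= fx fy] //; last by rewrite linf fx fy mulr0 addr0.
apply: closed_norm => x Kx; apply/eqP; rewrite -normr_le0.
rewrite real_leNgt ?normr_real ?real0//; apply/negP => fx0.
have x0 : 0 < `|x|.
  by rewrite normr_gt0; apply: contraTneq fx0 => ->; rewrite f0 normr0 ltxx.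
have c0 : 0 < c by rewrite -(pmulr_rgt0 _ x0) (lt_le_trans fx0).
have [y /= fy xy] := Kx _ (divr_gt0 fx0 c0).
have := fc (x - y).
have -> : f (x - y) = f x by rewrite addrC -scaleN1r linf fy mulr0 add0r.
by apply/negP; rewrite -real_ltNge ?realM ?normr_real ?gtr0_real// -ltr_pdivlMr.
Qed.

Lemma closed_subspace_orthocomp (M : set H) :
  closed_subspace (orthocomp dot M).
Proof.
split.
- suff -> : orthocomp dot M = \bigcap_(y in M) [set x | dot x y = 0].
    apply: closed_bigI => y _.
    have [|x|//] := @closed_subspace_functional_ker (dot^~ y) `|y|.
      by move=> a x z; rewrite dotDl dotZl.
    exact: CauchySchwarz_dot.
  by apply/seteqP; split=> x Mx y; exact: Mx.
- by move=> y _; rewrite dot0l.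
- by move=> a x y Mx My z Mz; rewrite dotDl dotZl Mx// My// mulr0 addr0.
Qed.

Lemma orthocompS (M N : set H) :
  M `<=` N -> orthocomp dot N `<=` orthocomp dot M.
Proof. by move=> MN x Nx y My; exact/Nx/MN. Qed.

Lemma orthocomp_self (M : set H) x : M x -> orthocomp dot M x -> x = 0.
Proof. by move=> Mx Ox; exact/dotxx_eq0/Ox. Qed.

Lemma sub_orthocompC (M N : set H) :
  M `<=` orthocomp dot N -> N `<=` orthocomp dot M.
Proof. by move=> MN x Nx y My; apply/dot_eq0C/MN. Qed.

Lemma smallest_orthocomp (A : set H) :
  orthocomp dot (smallest closed_subspace A) = orthocomp dot A.
Proof.
apply/seteqP; split; first by apply: orthocompS; exact: sub_gen_smallest.
apply: sub_orthocompC; apply: smallest_sub.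
  exact: closed_subspace_orthocomp.
exact: sub_orthocompC.
Qed.

(** * The projection theorem *)

(** The norm as a real number: infima of distances make sense in [R] but not in
    the partially ordered [R[i]]. *)
Let nrm (x : H) : R := complex.Re `|x|.

Lemma nrmE x : `|x| = (nrm x)%:C.
Proof. by rewrite RRe_real// normr_real. Qed.

Lemma nrm_ge0 x : 0 <= nrm x.
Proof. by rewrite -ler0c -nrmE. Qed.

Lemma nrmD x y : nrm (x + y) <= nrm x + nrm y.
Proof. by rewrite -lecR raddfD/= -!nrmE ler_normD. Qed.

Lemma dot_nrm x : dot x x = (nrm x ^+ 2)%:C.
Proof. by rewrite -dot_norm nrmE rmorphXn. Qed.

Lemma nrm_dot x : nrm x ^+ 2 = complex.Re (dot x x).
Proof. by rewrite dot_nrm. Qed.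

Lemma nrm_parallelogram x y :
  nrm (x - y) ^+ 2 + nrm (x + y) ^+ 2 = (nrm x ^+ 2 + nrm y ^+ 2) *+ 2.
Proof.
rewrite !nrm_dot -!raddfD -raddfMn; congr (complex.Re _).
rewrite dotBl !dotBr dotDl !dotDr mulr2n.
set a := dot x x; set b := dot y y; set c := dot x y; set d := dot y x.
by ring.
Qed.

Lemma nrmZ (a : R) x : nrm (a%:C *: x) = `|a| * nrm x.
Proof.
apply: complexI; rewrite rmorphM/= -!nrmE normrZ; congr (_ * _).
by rewrite normc_def/= expr0n/= addr0 sqrtr_sqr.
Qed.

Lemma cauchy_seq_cvg (u : nat -> H) :
  (forall e, 0 < e -> exists N, forall m n, (N <= m)%N -> (N <= n)%N ->
    `|u m - u n| < e) ->
  exists p, forall e, 0 < e -> exists N, forall n, (N <= n)%N -> `|p - u n| < e.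
Proof.
move=> cu; have /cauchy_cvgP/cvg_ex[p up] : cauchy (u @ \oo).
  apply/cauchy_exP => e e0; have [N uN] := cu e e0.
  exists (u N); exists N => // n /= Nn.
  by rewrite -ball_normE/=; apply: uN.
exists p => e e0; move/cvgrPdist_lt/(_ e e0): up => -[N _ upN].
by exists N => n Nn; exact: upN.
Qed.

(** The parallelogram law at [x - v] and [x - w], whose half-sum is the vector
    from the midpoint of [v] and [w] to [x]. *)
Lemma near_minimizers_close (x v w : H) (d delta : R) :
  0 <= d -> 0 <= delta -> d <= nrm (x - 2^-1%:C *: (v + w)) ->
  nrm (x - v) < d + delta -> nrm (x - w) < d + delta ->
  nrm (v - w) ^+ 2 < 8 * (d * delta) + 4 * delta ^+ 2.
Proof.
move=> d0 delta0 mid_d vd wd.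
have midE : (x - w) + (x - v) = 2%:C *: (x - 2^-1%:C *: (v + w)).
  rewrite scalerBr scalerA -rmorphM/= mulfV// rmorph1 scale1r.
  rewrite -[2]/(1 + 1) rmorphD/= rmorph1 scalerDl scale1r.
  by rewrite addrACA -opprD (addrC w).
have gapE : (x - w) - (x - v) = v - w by rewrite opprB addrC addrA subrK.
have := nrm_parallelogram (x - w) (x - v).
rewrite gapE midE nrmZ normr_nat exprMn => para.
have dd : 0 <= d + delta by rewrite addr_ge0.
have vd2 : nrm (x - v) ^+ 2 < (d + delta) ^+ 2.
  by rewrite ltr_pXn2r ?nnegrE ?nrm_ge0.
have wd2 : nrm (x - w) ^+ 2 < (d + delta) ^+ 2.
  by rewrite ltr_pXn2r ?nnegrE ?nrm_ge0.
have mid_d2 : d ^+ 2 <= nrm (x - 2^-1%:C *: (v + w)) ^+ 2.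
  by rewrite ler_pXn2r ?nnegrE ?nrm_ge0.
have dd2 : (d + delta) ^+ 2 = d ^+ 2 + 2 * (d * delta) + delta ^+ 2 by ring.
rewrite dd2 in vd2 wd2; lra.
Qed.

(** A sequence of points of [M] whose distances to [x] approach the infimum is
    Cauchy by the parallelogram law; its limit [p] is a closest point of [M]
    to [x], and no line of [M] through [p] comes closer, so that [x - p] is
    orthogonal to [M]. *)
Theorem projection (M : set H) x :
  closed_subspace M -> exists2 p, M p & orthocomp dot M (x - p).
Proof.
move=> cM; pose D := [set nrm (x - y) | y in M]; pose d := inf D.
have infD : has_inf D.
  split; first by exists (nrm (x - 0)); exists 0 => //; exact: subspace0.
  by exists 0 => _ [y _ <-]; exact: nrm_ge0.
have d_le y : M y -> d <= nrm (x - y).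
  by move=> My; apply: ge_inf; [exact: (proj2 infD)|exists y].
have d0 : 0 <= d.
  by apply: lb_le_inf; [case: infD|move=> _ [y _ <-]; exact: nrm_ge0].
have [u uP] : {u : nat -> H &
    forall n, M (u n) /\ nrm (x - u n) < d + n.+1%:R^-1}.
  apply: (@choice _ _ (fun n y => M y /\ nrm (x - y) < d + n.+1%:R^-1)) => n.
  have n0 : (0 : R) < n.+1%:R^-1 by rewrite invr_gt0.
  by have [_ [y My <-] yd] := inf_adherent n0 infD; exists y.
have [p pP] : exists p, forall e, 0 < e ->
    exists N, forall n, (N <= n)%N -> `|p - u n| < e.
  apply: cauchy_seq_cvg => e0 e00.
  have [e e_gt0 ->] : exists2 e : R, 0 < e & e0 = e%:C.
    exists (complex.Re e0); last by rewrite RRe_real// gtr0_real.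
    by rewrite -ltcR RRe_real// gtr0_real.
  (* With [delta <= 1] the bound [8 d delta + 4 delta ^ 2] on the squared gap is
     at most [(8 d + 4) delta], which this choice keeps below [e ^ 2]. *)
  pose delta := Num.min 1 (e ^+ 2 / (8 * d + 4)).
  have d4 : 0 < 8 * d + 4 by lra.
  have delta0 : 0 < delta by rewrite lt_min ltr01 divr_gt0// exprn_gt0.
  have delta1 : delta <= 1 by rewrite ge_min lexx.
  have deltae : (8 * d + 4) * delta <= e ^+ 2.
    by rewrite mulrC -ler_pdivlMr// ge_min lexx orbT.
  have [N Ndelta] : exists N, forall n, (N <= n)%N -> nrm (x - u n) < d + delta.
    have [N _ NP] := near_infty_natSinv_lt (PosNum delta0).
    exists N => n Nn; apply: (lt_trans (proj2 (uP n))).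
    by rewrite ltrD2l; exact: NP.
  exists N => m n Nm Nn; rewrite nrmE ltcR.
  have {}Nm := Ndelta _ Nm; have {}Nn := Ndelta _ Nn.
  have midM : M (2^-1%:C *: (u m + u n)).
    by apply: subspaceZ => //; apply: subspaceD => //; apply: (proj1 (uP _)).
  have gap := near_minimizers_close d0 (ltW delta0) (d_le _ midM) Nm Nn.
  rewrite -(@ltr_pXn2r _ 2) ?nnegrE ?nrm_ge0 ?(ltW e_gt0)//.
  apply: (lt_le_trans gap); apply: le_trans deltae.
  by rewrite [leRHS]mulrDl -[in leRHS]mulrA lerD2l ler_pM2l// expr2 ler_piMr// ltW.
have Mp : M p.
  have [clM _ _] := cM; apply: (closed_approx clM) => e e0.
  have [N pN] := pP e e0; exists (u N); last exact: pN.
  by have [] := uP N.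
exists p => // m Mm; have [->|m0] := eqVneq m 0; first by rewrite dot0r.
have pd : nrm (x - p) <= d.
  apply/ler_addgt0Pr => e e0; have e20 : 0 < e / 2 by rewrite divr_gt0.
  have [N1 NP1] : exists N, forall n, (N <= n)%N -> nrm (x - u n) < d + e / 2.
    have [N _ NP] := near_infty_natSinv_lt (PosNum e20).
    exists N => n Nn; apply: (lt_trans (proj2 (uP n))).
    by rewrite ltrD2l; exact: NP.
  have [|N2 NP2] := pP (e / 2)%:C; first by rewrite ltcR.
  have {NP1}h1 := NP1 _ (leq_maxl N1 N2).
  have {NP2} := NP2 _ (leq_maxr N1 N2); rewrite -normrN opprB nrmE ltcR => h2.
  have := nrmD (x - u (maxn N1 N2)) (u (maxn N1 N2) - p).
  by rewrite addrA subrK; lra.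
have /= := dot_line (x - p) m0.
set c := dot (x - p) m / dot m m => dist_line.
have closest : dot (x - p) (x - p) <= dot (x - p - c *: m) (x - p - c *: m).
  rewrite !dot_nrm lecR ler_pXn2r ?nnegrE ?nrm_ge0// (le_trans pd)//.
  rewrite -addrA -opprD; apply: d_le; apply: subspaceD => //.
  exact: subspaceZ.
move: closest; rewrite dist_line lerBrDr gerDl pmulr_lle0 ?invr_gt0 ?dnorm_gt0//.
rewrite real_exprn_even_le0 ?normr_real//= normr_eq0 => /eqP //.
Qed.

End HilbertGeometry.

Arguments dotxx_eq0 {R H} dot x.
Arguments dot_inj {R H} dot x y.

(** * Adjoints of isometries *)

Section Adjoint.

Variables (R : realType) (H : completeNormedModType R[i]).
Variable dot : {dot H for Num.conj}.
Hypothesis dot_norm : hilbert_norm dot.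

(** The representing vector is a multiple of a nonzero vector [w] orthogonal to
    the kernel of [f]: every [x] differs from [(f x / f w) w] by a vector of the
    kernel, so [dot x w] is proportional to [f x]. *)
Lemma riesz (f : H -> R[i]) (c : R[i]) :
  (forall a x y, f (a *: x + y) = a * f x + f y) ->
  (forall x, `|f x| <= `|x| * c) ->
  exists z, forall x, f x = dot x z.
Proof.
move=> linf fc.
have f0 : f 0 = 0 by have := linf (-1) 0 0; rewrite scaler0 addr0 mulN1r addNr.
have fD x y : f (x + y) = f x + f y by have := linf 1 x y; rewrite scale1r mul1r.
have fZ a x : f (a *: x) = a * f x by have := linf a x 0; rewrite f0 !addr0.
pose K := [set x | f x = 0].
have cK : closed_subspace K := closed_subspace_functional_ker linf fc.
have [KT|/existsNP[v fv]] := pselect (forall x, f x = 0).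
  by exists 0 => x; rewrite dot0r KT.
have [p fp Kvp] := projection dot_norm v cK.
pose w := v - p.
have fw0 : f w != 0.
  by rewrite /w fD -scaleN1r fZ [f p]fp mulr0 addr0; apply/eqP.
have ww0 : dot w w != 0.
  by rewrite dnorm_eq0; apply: contraNneq fw0 => ->; rewrite f0.
exists (Num.conj (f w / dot w w) *: w) => x.
rewrite dotZr conjCK.
have : dot w (x - (f x / f w) *: w) = 0.
  apply: Kvp; rewrite /K/= fD -scaleNr fZ mulNr divfK// subrr//.
move/dot_eq0C/eqP; rewrite dotBl dotZl subr_eq0 => /eqP ->.
by rewrite mulrA; field; rewrite fw0 ww0.
Qed.

Lemma adjoint_on_eq (M : set H) T y z : closed_subspace M ->
  M z -> (forall x, M x -> dot (T x) y = dot x z) -> adjoint_on dot M T y = z.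
Proof.
move=> cM Mz Tz; rewrite /adjoint_on.
case: xgetP => [_ -> [Mz' Tz']|/(_ z)[]//].
set z' := xget _ _ in Mz' Tz' *; apply/subr0_eq/(dotxx_eq0 dot).
have Mzz' : M (z' - z) by exact: subspaceB.
by rewrite dotBr -Tz// -Tz'// subrr.
Qed.

(** A relation rather than the function [adjoint], because it is symmetric and
    passes to iterates without any existence question. *)
Definition adjoint_pair (T S : H -> H) := forall x y, dot (T x) y = dot x (S y).

Lemma adjoint_pairC T S : adjoint_pair T S -> adjoint_pair S T.
Proof. by move=> TS x y; rewrite dotC -TS -dotC. Qed.

Lemma adjoint_pair_linear T S : adjoint_pair T S -> linear S.
Proof.
move=> TS a x y; apply: (dot_inj dot) => z.
by rewrite -TS dotDr dotZr !TS dotDr dotZr.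
Qed.

Lemma isometry_adjoint_pair (T : {linear H -> H}) :
  isometry_on setT T -> adjoint_pair T (adjoint dot T).
Proof.
move=> isoT x y.
have [z Tz] : exists z, forall x, dot (T x) y = dot x z.
  apply: (@riesz _ `|y|) => [a u v|u]; first by rewrite linearP dotDl dotZl.
  have [_ <-] := isoT u I.
  exact: CauchySchwarz_dot.
rewrite Tz; congr (dot x _); symmetry.
by apply: adjoint_on_eq => // _ *; exact: closed_subspaceT.
Qed.

(** Norm preservation says that the self-adjoint operator [D := S T - 1] has
    [dot x (D x) = 0] everywhere; at [x + D x] this reads [|D x| = 0]. *)
Lemma isometry_adjointK T S : isometry_on setT T -> adjoint_pair T S ->
  cancel T S.
Proof.
move=> isoT TS x; have ST := adjoint_pairC TS.
pose D y := S (T y) - y.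
have linS := adjoint_pair_linear TS; have linT := adjoint_pair_linear ST.
have DD y z : D (y + z) = D y + D z.
  have := linT 1 y z; have := linS 1 (T y) (T z); rewrite !scale1r /D => + ->.
  by move=> ->; rewrite opprD addrACA.
have DC y z : dot (D y) z = dot y (D z).
  by rewrite dotBl dotBr ST TS.
have D0 y : dot y (D y) = 0.
  rewrite dotBr -TS -!dot_norm.
  by have [_ ->] := isoT y I; rewrite subrr.
suff Dx0 : D x = 0 by exact/subr0_eq.
apply: (dotxx_eq0 dot); clearbody D.
have := D0 (x + D x); rewrite DD dotDl !dotDr !D0 addr0 add0r -DC.
by rewrite -mulr2n => /eqP; rewrite mulrn_eq0/= => /eqP.
Qed.

(** A unitary in the sense of [unitary_on] is surjective, so its adjoint can
    take the default value [0] only at the vector [0], where it is correct. *)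
Lemma unitary_adjoint_pair (U : {linear H -> H}) :
  unitary_on dot setT U -> adjoint_pair U (adjoint dot U).
Proof.
move=> uU x y.
have [_ _ Uy] := uU y I.
rewrite /adjoint/adjoint_on in Uy *.
case: xgetP Uy => [z -> [_ Uz] _|_]; first exact: Uz.
by rewrite linear0 => <-; rewrite !dot0r.
Qed.

End Adjoint.

(** * The Wold decomposition of one isometry *)

Section Wold.

Variables (R : realType) (H : completeNormedModType R[i]).
Variable dot : {dot H for Num.conj}.
Hypothesis dot_norm : hilbert_norm dot.

Local Notation orth := (orthocomp dot).

Lemma orthocompK (M : set H) : closed_subspace M -> orth (orth M) = M.
Proof.
move=> cM; apply/seteqP; split=> [x OOx|x Mx y Oy]; last exact/dot_eq0C/Oy.
have [p Mp Ox] := projection dot_norm x cM.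
have Op : orth (orth M) p by move=> y Oy; exact/dot_eq0C/Oy.
suff -> : x = p by [].
apply/subr0_eq; apply: (orthocomp_self (dot := dot) (M := orth M)) => //.
exact: (subspaceB (closed_subspace_orthocomp dot_norm _)).
Qed.

Section Pair.

Variables T S : H -> H.
Hypothesis TS : adjoint_pair dot T S.
Hypothesis TK : cancel T S.

Let linS : linear S := adjoint_pair_linear TS.

Let S0 : S 0 = 0.
Proof. by have := linS (-1) 0 0; rewrite scaler0 addr0 scaleN1r addNr. Qed.

Let SD x y : S (x + y) = S x + S y.
Proof. by have := linS 1 x y; rewrite !scale1r. Qed.

Let SN x : S (- x) = - S x.
Proof. by have := linS (-1) x 0; rewrite S0 !addr0 !scaleN1r. Qed.

Lemma pair_norm x : `|T x| = `|x|.
Proof. by apply: (eq_norm_dot dot_norm); rewrite TS TK. Qed.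

Lemma pair_dot x y : dot (T x) (T y) = dot x y.
Proof. by rewrite TS TK. Qed.

Lemma orth_range_ker x y : S y = 0 -> dot (T x) y = 0.
Proof. by move=> Sy; rewrite TS Sy dot0r. Qed.

Lemma ker_defect x : S (x - T (S x)) = 0.
Proof. by rewrite SD SN TK subrr. Qed.

(** [T S x] and the defect [x - T S x] are orthogonal, and [|T S x| = |S x|]. *)
Lemma pair_adjoint_le x : `|S x| <= `|x|.
Proof.
have xE : x = T (S x) + (x - T (S x)) by rewrite addrC subrK.
rewrite -(@ler_pXn2r _ 2) ?nnegrE// !dot_norm [in leRHS]xE dot_pythagoras.
  by rewrite pair_dot lerDl dnorm_ge0.
exact/orth_range_ker/ker_defect.
Qed.

Lemma orthocomp_ker x : orth (S @^-1` [set 0]) x <-> T (S x) = x.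
Proof.
split=> [Ox|<- y /= Sy]; last exact: orth_range_ker.
apply/esym/subr0_eq/(dotxx_eq0 dot).
have /= kx := ker_defect x.
by rewrite dotBl Ox// orth_range_ker// subrr.
Qed.

Lemma closed_subspace_ker : closed_subspace (S @^-1` [set 0]).
Proof.
suff -> : S @^-1` [set 0] = orth (range T) by exact: closed_subspace_orthocomp.
apply/seteqP; split=> [y /= Sy _ [x _ <-]|y Oy].
  exact/dot_eq0C/orth_range_ker.
by apply: (dot_inj dot) => x; rewrite -TS dot0r; apply/dot_eq0C/Oy; exists x.
Qed.

(** The image is cut out by conditions on [S], which is contractive, so that no
    limit of preimages has to be taken. *)
Lemma closed_subspace_image (M : set H) :
  closed_subspace M -> closed_subspace (T @` M).
Proof.
move=> cM.
suff -> : T @` M = S @^-1` M `&` orth (S @^-1` [set 0]).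
  apply: closed_subspaceI; last exact: closed_subspace_orthocomp.
  by apply: closed_subspace_preimage => //; exact: pair_adjoint_le.
apply/seteqP; split=> [_ [x Mx <-]|x [Mx /orthocomp_ker <-]]; last by exists (S x).
by split; [rewrite /preimage/= TK|apply/orthocomp_ker; rewrite TK].
Qed.

End Pair.

Lemma adjoint_pair_iter T S n :
  adjoint_pair dot T S -> adjoint_pair dot (iter n T) (iter n S).
Proof.
move=> TS x; elim: n x => [//|n IHn] x y.
by rewrite iterS TS IHn -iterSr.
Qed.

Lemma cancel_iter (T S : H -> H) n : cancel T S -> cancel (iter n T) (iter n S).
Proof.
by move=> TK x; elim: n x => [//|n IHn] x; rewrite iterSr iterS TK IHn.
Qed.

(** For an adjoint pair this is equivalent to [reduces M T], by [reducesP];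
    invariance under [S] replaces invariance of the orthogonal complement. *)
Definition reducing (M : set H) (T S : H -> H) :=
  [/\ closed_subspace M, forall x, M x -> M (T x) & forall x, M x -> M (S x)].

Lemma reducesP M T S : adjoint_pair dot T S -> reduces dot M T <-> reducing M T S.
Proof.
move=> TS; split=> [[cM TM TO]|[cM TM SM]].
  split=> // x Mx; first by apply: TM; exists x.
  rewrite -(orthocompK cM) => y Oy; apply: dot_eq0C; rewrite -TS.
  by have := TO (T y) (imageP _ Oy); apply.
split=> // [_ [x Mx <-]|_ [x Ox <-]]; first exact: TM.
by move=> y My; rewrite TS; apply/Ox/SM.
Qed.

Lemma reducing_orthocomp M T S :
  adjoint_pair dot T S -> reducing M T S -> reducing (orth M) T S.
Proof.
move=> TS [cM TM SM]; split; first exact: closed_subspace_orthocomp.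
  by move=> x Ox y My; rewrite TS; apply/Ox/SM.
by move=> x Ox y My; rewrite (adjoint_pairC TS); apply/Ox/TM.
Qed.

Lemma reducingI M N T S :
  reducing M T S -> reducing N T S -> reducing (M `&` N) T S.
Proof.
move=> [cM TM SM] [cN TN SN]; split; first exact: closed_subspaceI.
  by move=> x [Mx Nx]; split; [exact: TM|exact: TN].
by move=> x [Mx Nx]; split; [exact: SM|exact: SN].
Qed.

Lemma reducingT T S : reducing setT T S.
Proof. by split=> //; exact: closed_subspaceT. Qed.

Lemma iter_stable (M : set H) (f : H -> H) n :
  (forall x, M x -> M (f x)) -> forall x, M x -> M (iter n f x).
Proof. by move=> fM x Mx; elim: n => [//|n IHn]; exact: fM. Qed.

Section Parts.

Variables T S : H -> H.
Hypothesis TS : adjoint_pair dot T S.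
Hypothesis TK : cancel T S.

Let TSn n : adjoint_pair dot (iter n T) (iter n S) := adjoint_pair_iter n TS.
Let TKn n : cancel (iter n T) (iter n S) := cancel_iter n TK.

(** Defined through the wandering subspaces [T ^ n (ker S)] so as to be a closed
    subspace by construction; [unitary_partP] identifies it with the
    intersection of the ranges of the powers of [T]. *)
Definition unitary_part : set H :=
  orth (\bigcup_n (iter n T @` (S @^-1` [set 0]))).

Definition shift_part : set H := orth unitary_part.

Lemma unitary_partP x :
  unitary_part x <-> forall n, iter n T (iter n S x) = x.
Proof.
split=> [Ox n|xT y [n _ [w /= Sw <-]]].
  elim: n => // n IHn; rewrite iterSr [iter n.+1 S x]iterS.
  suff -> : T (S (iter n S x)) = iter n S x by [].
  apply/(orthocomp_ker TS TK) => w Sw.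
  rewrite (adjoint_pairC (TSn n)); apply: Ox.
  by exists n => //; exists w.
by rewrite -(xT n.+1) iterSr TSn TKn TS Sw dot0r.
Qed.

Lemma unitary_partE : unitary_part = \bigcap_n (iter n T @` setT).
Proof.
apply/seteqP; split=> [x /unitary_partP xT n _|x xT].
  by exists (iter n S x).
apply/unitary_partP => n; have [y _ <-] := xT n I.
by rewrite TKn.
Qed.

Lemma closed_unitary_part : closed_subspace unitary_part.
Proof. exact: closed_subspace_orthocomp. Qed.

Lemma reducing_unitary_part : reducing unitary_part T S.
Proof.
split; first exact: closed_unitary_part.
  move=> x /unitary_partP xT; apply/unitary_partP => -[//|n].
  by rewrite iterS iterSr TK xT.
move=> x /unitary_partP xT; apply/unitary_partP => n.
by rewrite -iterSr -[in RHS](xT n.+1) [iter n.+1 T _]iterS TK.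
Qed.

Lemma reducing_shift_part : reducing shift_part T S.
Proof. exact/reducing_orthocomp/reducing_unitary_part. Qed.

(** The components [u] of [x] in the unitary part and [x - u] in the shift part
    stay in [M]: split [u = p + q] along [M] and its complement. Both being
    reducing, [q] is again in the unitary part, while [x - u + q] is in [M];
    hence [q] is orthogonal to itself. *)
Lemma wold_split M x : reducing M T S -> M x ->
  exists u s, [/\ M u, M s, unitary_part u, shift_part s & x = u + s].
Proof.
move=> rM Mx; have [cM TM SM] := rM.
have [u Uu Sxu] := projection dot_norm x closed_unitary_part.
have [p Mp Oq] := projection dot_norm u cM.
have [cO TO SO] := reducing_orthocomp TS rM.
have linTn n : linear (iter n T) by exact/adjoint_pair_linear/adjoint_pairC/TSn.
have linSn n : linear (iter n S) by exact/adjoint_pair_linear/TSn.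
have Uq : unitary_part (u - p).
  apply/unitary_partP => n; apply/subr0_eq.
  have PD (y z : H) : iter n T (iter n S (y - z)) =
      iter n T (iter n S y) - iter n T (iter n S z).
    by rewrite addrC -scaleN1r linSn linTn scaleN1r addrC.
  apply: (@orthocomp_self _ _ dot M); last first.
    exact: (subspaceB cO (iter_stable n TO (iter_stable n SO Oq)) Oq).
  rewrite PD (unitary_partP u).1// opprB addrC addrA subrK.
  exact: (subspaceB cM Mp (iter_stable n TM (iter_stable n SM Mp))).
have q0 : u - p = 0.
  apply: (dotxx_eq0 dot).
  have Mxp : M (x - p) by exact: subspaceB.
  have : dot (x - u) (u - p) = 0 by exact: Sxu.
  have -> : x - u = (x - p) - (u - p) by rewrite opprB addrA subrK.
  rewrite dotBl [dot (x - p) _](dot_eq0C (Oq _ Mxp)) sub0r => /eqP.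
  by rewrite oppr_eq0 => /eqP.
have Mu : M u by rewrite (subr0_eq q0).
exists u, (x - u); split=> //; last by rewrite addrC subrK.
exact: subspaceB.
Qed.

Section Span.

Variable M : set H.
Hypothesis rM : reducing M T S.

(** A vector [x] of [M] orthogonal to all [T ^ n (M & ker S)] is in the unitary
    part: each defect [S ^ n x - T S (S ^ n x)] lies in [M & ker S] and
    is orthogonal to itself. *)
Lemma shift_part_span : M `&` shift_part =
  smallest closed_subspace (\bigcup_n (iter n T @` (M `&` S @^-1` [set 0]))).
Proof.
have [cM TM SM] := rM.
have [cS TSh SSh] := reducing_shift_part.
have cI : closed_subspace (M `&` shift_part) by exact: closed_subspaceI.
set A := \bigcup_n _; have AI : A `<=` M `&` shift_part.
  move=> _ [n _ [w [Mw Sw] <-]]; split; first exact: (iter_stable n TM).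
  move=> y Uy; apply/dot_eq0C/Uy.
  by exists n => //; exists w.
apply/seteqP; split; last exact: smallest_sub.
have cL := closed_subspace_smallest A.
move=> x [Mx Sx]; have [p Lp Oq] := projection dot_norm x cL.
have [Mp Sp] : (M `&` shift_part) p by exact: smallest_sub Lp.
suff Uq : unitary_part (x - p).
  have Sq : shift_part (x - p) by exact: (subspaceB cS).
  by rewrite (subr0_eq (orthocomp_self (M := unitary_part) Uq Sq)).
have Mq : M (x - p) by exact: subspaceB.
move: Oq; rewrite (smallest_orthocomp dot_norm).
move: (x - p) Mq => {Mx Sx Lp Mp Sp}x Mx Ox.
apply/unitary_partP; elim=> // n IHn.
rewrite iterSr [iter n.+1 S x]iterS.
suff -> : T (S (iter n S x)) = iter n S x by [].
have Mn : M (iter n S x) by exact: (iter_stable n SM).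
have kn := ker_defect TS TK (iter n S x).
apply/esym/subr0_eq/(dotxx_eq0 dot).
rewrite dotBl (orth_range_ker TS)// subr0 (adjoint_pairC (TSn n)).
apply: Ox; exists n => //; eexists; last by [].
by split=> //; apply: subspaceB => //; exact/TM/SM.
Qed.

(** For [i < j], [dot (T ^ i v) (T ^ j w) = dot v (T ^ (j - i) w)] vanishes when
    [v] is in [ker S], because [T ^ (j - i) w] is in the range of [T]. *)
Lemma shift_part_sum : is_orthogonal_sum dot (M `&` shift_part)
  (fun n => iter n T @` (M `&` S @^-1` [set 0])).
Proof.
have [cM TM SM] := rM; split; last exact: shift_part_span.
  move=> n; apply: (closed_subspace_image (TSn n) (TKn n)).
  by apply: closed_subspaceI => //; exact: closed_subspace_ker.
have lt_orth i j v w : (i < j)%N -> S v = 0 -> dot (iter i T v) (iter j T w) = 0.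
  move=> ij Sv; rewrite -(subnK ij) addnC addSnnS iterD (pair_dot (TSn i) (TKn i)) iterS.
  by apply/dot_eq0C/(orth_range_ker TS).
move=> i j ij _ [v [_ Sv] <-] _ [w [_ Sw] <-].
have [/lt_orth->//|/lt_orth vw|//] := ltngtP i j.
exact/dot_eq0C/vw.
Qed.

End Span.

(** Since all [S ^ n] are contractions, the vectors with [S ^ n x --> 0] form a
    closed subspace; it contains each [T ^ m (ker S)], on which [S ^ n] vanishes
    for [n > m], hence the shift part. Conversely the unitary component [u] of
    such a vector satisfies [|u| = |S ^ n u| --> 0]. *)
Lemma shift_part_cvg x : shift_part x <-> iter n S x @[n --> \oo] --> (0 : H).
Proof.
have linSn n : linear (iter n S) by exact/adjoint_pair_linear/TSn.
have SnD n (y z : H) : iter n S (y + z) = iter n S y + iter n S z.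
  by have := linSn n 1 y z; rewrite !scale1r.
have Sn_le n y : `|iter n S y| <= `|y| :=
  pair_adjoint_le (TSn n) (TKn n) y.
pose C := [set y : H | iter n S y @[n --> \oo] --> (0 : H)].
have cC : closed_subspace C.
  split.
  - apply: closed_norm => y Cy; apply/cvgrPdist_lt => e e0.
    have e20 : 0 < e / 2 by rewrite divr_gt0.
    have [z /cvgrPdist_lt/(_ _ e20)[N _ zN] yz] := Cy _ e20.
    exists N => // n Nn; rewrite sub0r normrN -(subrK z y) SnD [e]splitr.
    rewrite (le_lt_trans (ler_normD _ _))// ltrD//.
      exact: le_lt_trans (Sn_le n _) yz.
    by have := zN n Nn; rewrite /= sub0r normrN.
  - rewrite /C/=; apply/cvgrPdist_lt => e e0; exists 0 => // n _ /=.
    by rewrite sub0r normrN (le_lt_trans (Sn_le n 0))// normr0.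
  - move=> a y z Cy Cz; rewrite /C/=.
    under eq_fun do rewrite linSn.
    rewrite -[0](addr0 0) -[X in nbhs (X + _)](scaler0 _ a).
    by apply: cvgD => //; exact: cvgZr.
have shiftC : shift_part `<=` C.
  have := shift_part_span (reducingT T S); rewrite setTI => ->.
  apply: smallest_sub => // _ [m _ [w [_ /= Sw] <-]].
  apply/cvgrPdist_lt => e e0; exists m.+1 => // n /= mn.
  rewrite sub0r normrN -(subnK mn) iterD iterS TKn Sw.
  by rewrite (le_lt_trans (Sn_le _ _))// normr0.
split=> [/shiftC//|Cx].
have [u [s [_ _ Uu Ss xE]]] := wold_split (reducingT T S) (I : setT x).
suff u0 : u = 0 by rewrite xE u0 add0r.
have Cu : C u.
  have -> : u = x - s by rewrite xE addrK.
  by apply: (subspaceB cC) => //; exact: shiftC.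
apply/eqP; rewrite -normr_eq0; apply: contraT => u0.
move/cvgrPdist_lt/(_ `|u|): Cu; rewrite lt_def normr_ge0 u0 => /(_ isT)[N _ /(_ N)].
rewrite /= sub0r normrN -(pair_norm (TSn N) (TKn N) (iter N S u)).
by rewrite (unitary_partP u).1// ltxx; apply.
Qed.

Lemma adjoint_on_reducing M y :
  reducing M T S -> M y -> adjoint_on dot M T y = S y.
Proof.
by move=> [cM _ SM] My; apply: (adjoint_on_eq cM (SM y My)) => x _; exact: TS.
Qed.

Lemma iter_adjoint_on_reducing M n y : reducing M T S -> M y ->
  iter n (adjoint_on dot M T) y = iter n S y.
Proof.
move=> rM My; elim: n => //= n ->; apply: adjoint_on_reducing => //.
by have [_ _ SM] := rM; exact: (iter_stable n SM).
Qed.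

Lemma unitary_on_unitary_part M :
  reducing M T S -> M `<=` unitary_part -> unitary_on dot M T.
Proof.
move=> rM MU x Mx; have [_ TM _] := rM; have MTx := TM x Mx.
split=> //; first by rewrite adjoint_on_reducing.
by rewrite adjoint_on_reducing//; exact: (unitary_partP x).1 (MU x Mx) 1%N.
Qed.

(** Iterating the surjectivity of [T] on [M] puts [M] in the range of every power
    of [T]. *)
Lemma sub_unitary_part M : M 0 -> unitary_on dot M T -> M `<=` unitary_part.
Proof.
move=> M0 uM; rewrite unitary_partE => x Mx n _.
suff [y My <-] : (iter n T @` M) x by exists y.
elim: n x Mx => [|n IHn] x Mx; first by exists x.
have [_ _ xE] := uM x Mx.
have [|y My yE] := IHn (adjoint_on dot M T x).
  by rewrite /adjoint_on; case: xgetP => [z -> []|].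
by exists y => //; rewrite iterS yE.
Qed.

Lemma shift_on_shift_part M :
  reducing M T S -> M `<=` shift_part -> shift_on dot M T.
Proof.
move=> rM MSh; have [_ TM _] := rM; split.
  by move=> x Mx; split; [exact: TM|exact: (pair_norm TS TK)].
move=> x Mx.
under eq_fun do rewrite iter_adjoint_on_reducing//.
exact/shift_part_cvg/MSh.
Qed.

Lemma sub_shift_part M :
  reducing M T S -> shift_on dot M T -> M `<=` shift_part.
Proof.
move=> rM [_ sM] x Mx; apply/shift_part_cvg; have := sM x Mx.
by under eq_fun do rewrite iter_adjoint_on_reducing//.
Qed.

(** Brings the wandering subspaces of the mixed summands, for example with
    [M = ker S2], into the form in which [shift_part_sum] produces them. *)
Lemma bigcap_iter_reducing M : reducing M T S ->
  \bigcap_n (iter n T @` M) = unitary_part `&` M.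
Proof.
move=> [_ TM SM]; apply/seteqP; split=> [x xM|x [/unitary_partP xT Mx] n _].
  split; last by have [y My <-] := xM 0%N I.
  by rewrite unitary_partE => n _; have [y _ <-] := xM n I; exists y.
by exists (iter n S x) => //; exact: (iter_stable n SM).
Qed.

End Parts.

End Wold.

(** * Doubly twisted pairs *)

Section Twisted.

Variables (R : realType) (H : completeNormedModType R[i]).
Variable dot : {dot H for Num.conj}.
Hypothesis dot_norm : hilbert_norm dot.

Local Notation orth := (orthocomp dot).
Local Notation ker S := (S @^-1` [set 0]).

(** The relations of [doubly_twisted] for arbitrary [S1], [S2], [U], [V], which
    stand for the adjoints of [T1] and [T2], the twist and its adjoint. All six
    maps are parameters so that the two isometries can be exchanged. *)
Definition twisted_by (T1 S1 T2 S2 U V : H -> H) :=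
  [/\ forall x, T1 (T2 x) = U (T2 (T1 x)),
      forall x, S1 (T2 x) = V (T2 (S1 x)),
      forall x, T1 (U x) = U (T1 x)
    & forall x, T2 (U x) = U (T2 x)].

Section Pairs.

Variables T1 S1 T2 S2 U V : H -> H.
Hypotheses (TS1 : adjoint_pair dot T1 S1) (TK1 : cancel T1 S1).
Hypotheses (TS2 : adjoint_pair dot T2 S2) (TK2 : cancel T2 S2).
Hypotheses (UV : adjoint_pair dot U V) (UK : cancel U V) (VK : cancel V U).
Hypothesis tw : twisted_by T1 S1 T2 S2 U V.

Lemma commute_adjoint (T S : H -> H) : adjoint_pair dot T S ->
  (forall x, T (U x) = U (T x)) ->
  [/\ forall x, T (V x) = V (T x), forall x, S (U x) = U (S x)
    & forall x, S (V x) = V (S x)].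
Proof.
move=> TS TU; have TV x : T (V x) = V (T x).
  by rewrite -[in RHS](VK x) TU UK.
have VU := adjoint_pairC UV.
split=> // x; apply: (dot_inj dot) => z.
  by rewrite -TS -VU -TV TS VU.
by rewrite -TS -UV -TU TS UV.
Qed.

(** The relation for [S2 T1] is the adjoint of the one for [S1 T2]. *)
Lemma twisted_byC : twisted_by T2 S2 T1 S1 V U.
Proof.
have [T12 S1T2 T1U T2U] := tw.
have [T1V S1U S1V] := commute_adjoint TS1 T1U.
have [T2V S2U S2V] := commute_adjoint TS2 T2U.
split=> // [x|x]; first by rewrite T12 UK.
have [VU ST1] := (adjoint_pairC UV, adjoint_pairC TS1).
rewrite -T1U -S2U; apply: (dot_inj dot) => z.
by rewrite -TS2 -ST1 S1T2 VU TS2 ST1.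
Qed.

(** [S1 T2 = V T2 S1] and, taking adjoints in [T2 T1 = V T1 T2],
    [S1 S2 = S2 S1 U]; both kill [ker S1]. *)
Lemma reducing_ker_twisted : reducing (ker S1) T2 S2.
Proof.
have [T12 S1T2 T1U T2U] := tw.
have [T1V S1U S1V] := commute_adjoint TS1 T1U.
have S0 (A B : H -> H) : adjoint_pair dot A B -> B 0 = 0.
  by move=> AB; apply: (dot_inj dot) => z; rewrite -AB !dot0r.
split; first exact: (closed_subspace_ker dot_norm TS1).
  by move=> x /= S1x; rewrite S1T2 S1x (S0 _ _ (adjoint_pairC TS2)) (S0 _ _ UV).
move=> x /= S1x.
have -> : S1 (S2 x) = S2 (S1 (U x)).
  apply: (dot_inj dot) => z; have [T21 _ _ _] := twisted_byC.
  by rewrite -TS1 -TS2 T21 (adjoint_pairC UV) TS1 TS2.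
by rewrite S1U S1x (S0 _ _ (adjoint_pairC UV)) (S0 _ _ TS2).
Qed.

(** Both [A = T2] and [A = S2] satisfy [A T1 = W T1 A] with [W = V] or [W = U]
    commuting with [T1], hence map the range of [T1 ^ n] into itself. *)
Lemma reducing_unitary_part_twisted : reducing (unitary_part dot T1 S1) T2 S2.
Proof.
have [T12 S1T2 T1U T2U] := tw.
have [T1V S1U S1V] := commute_adjoint TS1 T1U.
have [T21 S2T1 _ _] := twisted_byC.
have range_stable (A W : H -> H) : (forall x, A (T1 x) = W (T1 (A x))) ->
    (forall x, T1 (W x) = W (T1 x)) ->
    forall x, unitary_part dot T1 S1 x -> unitary_part dot T1 S1 (A x).
  move=> AT1 T1W x; rewrite unitary_partE// => xT n _.
  have [y _ <-] := xT n I; elim: n y {x xT} => [|n IHn] y; first by exists (A y).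
  have [z _ zE] := IHn y; exists (W z) => //.
  rewrite !iterS AT1 -zE -T1W; congr T1.
  by elim: n {IHn zE} => //= n ->.
split; first exact: closed_unitary_part.
  exact: (range_stable _ V).
exact: (range_stable _ U).
Qed.

End Pairs.

Section Parts.

Variables T1 S1 T2 S2 : H -> H.
Hypotheses (TS1 : adjoint_pair dot T1 S1) (TK1 : cancel T1 S1).
Hypotheses (TS2 : adjoint_pair dot T2 S2) (TK2 : cancel T2 S2).
Hypothesis ker1_red : reducing (ker S1) T2 S2.
Hypothesis U2_red : reducing (unitary_part dot T2 S2) T1 S1.

Local Notation U1 := (unitary_part dot T1 S1).
Local Notation U2 := (unitary_part dot T2 S2).
Local Notation Sh1 := (shift_part dot T1 S1).
Local Notation Sh2 := (shift_part dot T2 S2).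

Lemma unitary_unitary_partE : U1 `&` U2 =
  \bigcap_(m : nat * nat) (iter m.1 T1 @` (iter m.2 T2 @` setT)).
Proof.
have [_ _ S1U2] := U2_red.
apply/seteqP; split=> [x [/(unitary_partP TS1 TK1) xT1 U2x] m _|x xT].
  exists (iter m.1 S1 x); last exact: xT1.
  exists (iter m.2 S2 (iter m.1 S1 x)) => //.
  exact: ((unitary_partP TS2 TK2 _).1 (iter_stable m.1 S1U2 U2x)).
split; rewrite unitary_partE// => n _.
  by have [y _ <-] := xT (n, 0%N) I; exists y.
by have [_ [y _ <-] <-] := xT (0%N, n) I; exists y.
Qed.

(** Two nested applications of [shift_part_sum]: the shift parts meet in the sum
    of the [T1 ^ a (Sh2 & ker S1)], and [Sh2 & ker S1] is in turn the sum of the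
    [T2 ^ b (ker S1 & ker S2)]. *)
Lemma shift_shift_part_sum : is_orthogonal_sum dot (Sh1 `&` Sh2)
  (fun m : nat * nat => iter m.1 T1 @` (iter m.2 T2 @` (ker S1 `&` ker S2))).
Proof.
have Sh2_red := reducing_orthocomp dot_norm TS1 U2_red.
have [cI1 oI1 sI1] := shift_part_sum dot_norm TS1 TK1 Sh2_red.
have [cI2 oI2 sI2] := shift_part_sum dot_norm TS2 TK2 ker1_red.
have TSn n := adjoint_pair_iter n TS1.
have TKn n := cancel_iter n TK1.
have sub2 n : iter n T2 @` (ker S1 `&` ker S2) `<=` Sh2 `&` ker S1.
  by rewrite [Sh2 `&` _]setIC sI2 => x xn; apply: sub_gen_smallest; exists n.
split.
- by move=> m; exact: (closed_subspace_image dot_norm (TSn _) (TKn _)).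
- move=> [a b] [c d] /= abcd _ [v vb <-] _ [w wd <-].
  have [ac|ac] := eqVneq a c; last first.
    apply: (oI1 a c); first exact/eqP.
      by exists v => //; exact: sub2 vb.
    by exists w => //; exact: sub2 wd.
  rewrite -ac (pair_dot (TSn a) (TKn a)); apply: (oI2 b d) => //.
  by move=> bd; apply: abcd; rewrite ac bd.
rewrite setIC; apply/seteqP; split.
  rewrite sI1; apply: smallest_sub; first exact: closed_subspace_smallest.
  move=> _ [n _ [v vI <-]].
  set L := smallest _ _.
  suff : Sh2 `&` ker S1 `<=` iter n T1 @^-1` L by apply.
  rewrite [Sh2 `&` _]setIC sI2; apply: smallest_sub.
    apply: closed_subspace_preimage.
    - exact/adjoint_pair_linear/adjoint_pairC/TSn.
    - by move=> x; rewrite (pair_norm dot_norm (TSn n) (TKn n)).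
    - exact: closed_subspace_smallest.
  move=> _ [k _ [w wI <-]]; apply: sub_gen_smallest.
  by exists (n, k) => //; exists (iter k T2 w) => //; exists w.
rewrite sI1; apply: smallest_sub; first exact: closed_subspace_smallest.
move=> _ [m _ [v vI <-]]; apply: sub_gen_smallest.
by exists m.1 => //; exists v => //; exact: sub2 vI.
Qed.

End Parts.

(** If [h] in [M1] has components [x1, x2, x3, x4] along the [K i], then
    [h - x1] is in [M1] and equals [x2 + x3 + x4], which is orthogonal to [M1]. *)
Lemma orthogonal_decomposition4_uniq (K1 K2 K3 K4 M1 M2 M3 M4 : set H) :
  orthogonal_decomposition4 dot K1 K2 K3 K4 ->
  orthogonal_decomposition4 dot M1 M2 M3 M4 ->
  K1 `<=` M1 -> K2 `<=` M2 -> K3 `<=` M3 -> K4 `<=` M4 ->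
  [/\ K1 = M1, K2 = M2, K3 = M3 & K4 = M4].
Proof.
move=> [_ _ _ Kall] [[c1 c2 c3 c4] [n12 n13 n14] [n23 n24 n34] _] KM1 KM2 KM3 KM4.
have eqK (M : set H) (h k r : H) : closed_subspace M -> M h -> M k -> orth M r ->
    h = k + r -> h = k.
  move=> cM Mh Mk Or hE; apply/subr0_eq/(@orthocomp_self _ _ dot M).
    exact: subspaceB.
  by rewrite hE addrC addKr.
have OD (M : set H) x y z : orth M x -> orth M y -> orth M z -> orth M (x + y + z).
  move=> Ox Oy Oz; have cO := closed_subspace_orthocomp dot_norm M.
  by apply: (subspaceD cO) => //; exact: (subspaceD cO).
have [[n21 n31] n41] := (sub_orthocompC n12, sub_orthocompC n13, sub_orthocompC n14).
have [[n32 n42] n43] := (sub_orthocompC n23, sub_orthocompC n24, sub_orthocompC n34).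
split; apply/seteqP; split=> // h Mh;
  have [x1 [x2 [x3 [x4 [[Kx1 Kx2 Kx3 Kx4] hE]]]]] := Kall h.
- rewrite (@eqK M1 h x1 (x2 + x3 + x4))//; first exact: KM1.
    by apply: OD; [exact/n21/KM2|exact/n31/KM3|exact/n41/KM4].
  by rewrite hE !addrA.
- rewrite (@eqK M2 h x2 (x1 + x3 + x4))//; first exact: KM2.
    by apply: OD; [exact/n12/KM1|exact/n32/KM3|exact/n42/KM4].
  by rewrite hE !addrA [x2 + x1]addrC.
- rewrite (@eqK M3 h x3 (x1 + x2 + x4))//; first exact: KM3.
    by apply: OD; [exact/n13/KM1|exact/n23/KM2|exact/n43/KM4].
  by rewrite hE !addrA [x3 + x1]addrC [x1 + x3 + x2]addrAC.
- rewrite (@eqK M4 h x4 (x1 + x2 + x3))//; first exact: KM4.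
    by apply: OD; [exact/n14/KM1|exact/n24/KM2|exact/n34/KM3].
  by rewrite hE [RHS]addrC.
Qed.

End Twisted.

(** * The decomposition *)

Theorem theorem3p9 (R : realType) (H : completeNormedModType R[i])
    (dot : {dot H for Num.conj}) (dot_norm : hilbert_norm dot)
    (T1 T2 : {linear H -> H}) (T12 : doubly_twisted dot T1 T2) :
  exists Huu Hus Hsu Hss : set H,
    [/\ wold_decomposition dot T1 T2 Huu Hus Hsu Hss,
        forall Kuu Kus Ksu Kss : set H,
          wold_decomposition dot T1 T2 Kuu Kus Ksu Kss ->
          [/\ Kuu = Huu, Kus = Hus, Ksu = Hsu & Kss = Hss]
      & [/\ Huu = \bigcap_(m : nat * nat)
                    (iter m.1 T1 @` (iter m.2 T2 @` setT)),
            is_orthogonal_sum dot Hus (fun m2 : nat =>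
              iter m2 T2 @` (\bigcap_(m1 : nat)
                               (iter m1 T1 @` ker_adjoint dot T2))),
            is_orthogonal_sum dot Hsu (fun m1 : nat =>
              iter m1 T1 @` (\bigcap_(m2 : nat)
                               (iter m2 T2 @` ker_adjoint dot T1)))
          & is_orthogonal_sum dot Hss (fun m : nat * nat =>
              iter m.1 T1 @` (iter m.2 T2 @`
                (ker_adjoint dot T1 `&` ker_adjoint dot T2)))]].
Proof.
have [iso1 iso2 [U [uU [tT tS tU1 tU2]]]] := T12.
pose S1 := adjoint dot T1; pose S2 := adjoint dot T2; pose V := adjoint dot U.
have TS1 : adjoint_pair dot T1 S1 := isometry_adjoint_pair dot_norm iso1.
have TS2 : adjoint_pair dot T2 S2 := isometry_adjoint_pair dot_norm iso2.
have UV : adjoint_pair dot U V := unitary_adjoint_pair uU.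
have TK1 : cancel T1 S1 := isometry_adjointK dot_norm iso1 TS1.
have TK2 : cancel T2 S2 := isometry_adjointK dot_norm iso2 TS2.
have UK : cancel U V by move=> x; have [] := uU x I.
have VK : cancel V U by move=> x; have [] := uU x I.
have tw : twisted_by T1 S1 T2 S2 U V by [].
have tw' : twisted_by T2 S2 T1 S1 V U := twisted_byC TS1 TS2 UV UK VK tw.
have ker1_red := reducing_ker_twisted dot_norm TS1 TS2 UV UK VK tw.
have ker2_red := reducing_ker_twisted dot_norm TS2 TS1 (adjoint_pairC UV) VK UK tw'.
have U1_red2 := reducing_unitary_part_twisted dot_norm TS1 TK1 TS2 UV UK VK tw.
have U2_red1 :=
  reducing_unitary_part_twisted dot_norm TS2 TK2 TS1 (adjoint_pairC UV) VK UK tw'.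
have U1_red := reducing_unitary_part dot_norm TS1 TK1.
have U2_red := reducing_unitary_part dot_norm TS2 TK2.
have Sh1_red2 := reducing_orthocomp dot_norm TS2 U1_red2.
have Sh2_red1 := reducing_orthocomp dot_norm TS1 U2_red1.
have Sh1_red := reducing_shift_part dot_norm TS1 TK1.
have Sh2_red := reducing_shift_part dot_norm TS2 TK2.
set U1 := unitary_part dot T1 S1 in U1_red2 U1_red Sh1_red2.
set U2 := unitary_part dot T2 S2 in U2_red1 U2_red Sh2_red1.
set Sh1 := shift_part dot T1 S1 in Sh1_red.
set Sh2 := shift_part dot T2 S2 in Sh2_red.
have USh1 : U1 `<=` orthocomp dot Sh1 by exact: sub_orthocompC.
have USh2 : U2 `<=` orthocomp dot Sh2 by exact: sub_orthocompC.
have dec : orthogonal_decomposition4 dot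
    (U1 `&` U2) (U1 `&` Sh2) (Sh1 `&` U2) (Sh1 `&` Sh2).
  have [[cU1 _ _] [cU2 _ _]] := (U1_red, U2_red).
  have [[cS1 _ _] [cS2 _ _]] := (Sh1_red, Sh2_red).
  split.
  - by split; exact: closed_subspaceI.
  - split=> x [Ux1 Ux2] y [y1 y2].
    + exact: USh2 Ux2 _ y2.
    + exact: USh1 Ux1 _ y1.
    + exact: USh1 Ux1 _ y1.
  - split=> x [x1 x2] y [y1 y2].
    + exact: USh1 x1 _ y1.
    + exact: USh1 x1 _ y1.
    + exact: USh2 x2 _ y2.
  - move=> x.
    have [u [s [_ _ Uu Ss ->]]] :=
      wold_split dot_norm TS1 TK1 (reducingT T1 S1) (I : setT x).
    have [uu [us [U1uu U1us U2uu S2us ->]]] :=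
      wold_split dot_norm TS2 TK2 U1_red2 Uu.
    have [su [ss [S1su S1ss U2su S2ss ->]]] :=
      wold_split dot_norm TS2 TK2 Sh1_red2 Ss.
    by exists uu, us, su, ss; rewrite !addrA.
have [Ruu1 Rus1 Rsu1 Rss1] : [/\ reducing (U1 `&` U2) T1 S1,
    reducing (U1 `&` Sh2) T1 S1, reducing (Sh1 `&` U2) T1 S1
    & reducing (Sh1 `&` Sh2) T1 S1].
  by split; exact: reducingI.
have [Ruu2 Rus2 Rsu2 Rss2] : [/\ reducing (U1 `&` U2) T2 S2,
    reducing (U1 `&` Sh2) T2 S2, reducing (Sh1 `&` U2) T2 S2
    & reducing (Sh1 `&` Sh2) T2 S2].
  by split; exact: reducingI.
exists (U1 `&` U2), (U1 `&` Sh2), (Sh1 `&` U2), (Sh1 `&` Sh2); split.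
- split=> //.
  + by split; apply/(reducesP dot_norm _ TS1).
  + by split; apply/(reducesP dot_norm _ TS2).
  + split; split.
    * by apply: (unitary_on_unitary_part TS1 TK1) => // x [].
    * by apply: (unitary_on_unitary_part TS2 TK2) => // x [].
    * by apply: (unitary_on_unitary_part TS1 TK1) => // x [].
    * by apply: (shift_on_shift_part dot_norm TS2 TK2) => // x [].
    * by apply: (shift_on_shift_part dot_norm TS1 TK1) => // x [].
    * by apply: (unitary_on_unitary_part TS2 TK2) => // x [].
    * by apply: (shift_on_shift_part dot_norm TS1 TK1) => // x [].
    * by apply: (shift_on_shift_part dot_norm TS2 TK2) => // x [].
- move=> Kuu Kus Ksu Kss [decK [ruu1 rus1 rsu1 rss1] [ruu2 rus2 rsu2 rss2]].
  move=> [[uuu1 uuu2] [uus1 sus2] [ssu1 usu2] [sss1 sss2]].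
  have [[[_ Kuu0 _] [_ Kus0 _] [_ Ksu0 _] _] _ _ _] := decK.
  apply: (orthogonal_decomposition4_uniq dot_norm decK dec);
    rewrite subsetI; split.
  + exact: (sub_unitary_part TS1 TK1).
  + exact: (sub_unitary_part TS2 TK2).
  + exact: (sub_unitary_part TS1 TK1).
  + by apply: (sub_shift_part dot_norm TS2 TK2) => //; apply/(reducesP dot_norm _ TS2).
  + by apply: (sub_shift_part dot_norm TS1 TK1) => //; apply/(reducesP dot_norm _ TS1).
  + exact: (sub_unitary_part TS2 TK2).
  + by apply: (sub_shift_part dot_norm TS1 TK1) => //; apply/(reducesP dot_norm _ TS1).
  + by apply: (sub_shift_part dot_norm TS2 TK2) => //; apply/(reducesP dot_norm _ TS2).
- split.
  + exact: unitary_unitary_partE.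
  + rewrite (bigcap_iter_reducing TS1 TK1 ker2_red).
    exact: (shift_part_sum dot_norm TS2 TK2 U1_red2).
  + rewrite (bigcap_iter_reducing TS2 TK2 ker1_red) setIC.
    exact: (shift_part_sum dot_norm TS1 TK1 U2_red1).
  + exact: shift_shift_part_sum.
Qed.
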